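(* Let $\mathcal{J},\mathcal{K}$ be ideals on $\omega$. (1) If $\mathcal{I}=\mathcal{J}\otimes\mathcal{K}$, then $\mathfrak{b}(\mathcal{I},\mathcal{I},\mathrm{Fin})=\mathfrak{c}^+$. (2) If $\mathcal{I}=\mathcal{J}\otimes\{\emptyset\}$, then $\mathfrak{b}(\mathcal{I},\mathcal{I},\mathrm{Fin})=\mathfrak{b}(\mathcal{J},\mathcal{J},\mathrm{Fin})$. (3) If $\mathcal{I}=\{\emptyset\}\otimes\mathcal{K}$, then $\mathfrak{b}(\mathcal{I},\mathcal{I},\mathrm{Fin})=\mathfrak{b}(\mathcal{K},\mathcal{K},\mathrm{Fin})$.
   Context: An ideal on a countable infinite set $X$ is a family $\mathcal{I}\subseteq\mathcal{P}(X)$ closed under finite unions and subsets, containing all finite subsets, with $X\notin\mathcal{I}$; $\mathrm{Fin}$ denotes the ideal of finite subsets of the relevant set ($\omega$ or $\omega\times\omega$). For $A\subseteq\omega\times\omega$, $(A)_x=\{y:(x,y)\in A\}$. For ideals $\mathcal{J},\mathcal{K}$ on $\omega$: $\mathcal{J}\otimes\mathcal{K}=\{A\subseteq\omega^2:\{x:(A)_x\notin\mathcal{K}\}\in\mathcal{J}\}$, $\mathcal{J}\otimes\{\emptyset\}=\{A\subseteq\omega^2:\{x:(A)_x\ne\emptyset\}\in\mathcal{J}\}$, $\{\emptyset\}\otimes\mathcal{K}=\{A\subseteq\omega^2:(A)_x\in\mathcal{K}\text{ for all }x\}$. For an ideal $\mathcal{K}$ on $X$, $\widehat{\mathcal{P}}_{\mathcal{K}}$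 is the family of sequences $\langle A_n:n\in\omega\rangle$ of pairwise disjoint members of $\mathcal{K}$, and $\mathcal{P}_{\mathcal{K}}$ those with union $X$. For ideals on $X$: $\mathfrak{b}(\mathcal{I},\mathcal{J},\mathcal{K})=\min\{|\mathcal{E}|:\mathcal{E}\subseteq\widehat{\mathcal{P}}_{\mathcal{K}},\ \forall\langle A_n\rangle\in\mathcal{P}_{\mathcal{J}}\ \exists\langle E_n\rangle\in\mathcal{E}\ \bigcup_n(A_n\cap\bigcup_{i\le n}E_i)\notin\mathcal{I}\}$, with the convention $\min\emptyset=\mathfrak{c}^+$. *)

(* Defs.v *)
From mathcomp Require Import all_boot.
From mathcomp Require Import boolp classical_sets functions cardinality.

Set Implicit Arguments.
Unset Strict Implicit.
Unset Printing Implicit Defensive.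

Local Open Scope classical_set_scope.
Local Open Scope card_scope.

(** A cardinal number is an equipotence class of types, so that equality of
    cardinals is Leibniz equality: see [cardinal_ofP]. *)
Definition cardinal := Type -> Prop.

Definition cardinal_of T (A : set T) : cardinal := fun U => A #= [set: U].

Definition card_lt T U (A : set T) (B : set U) : Prop :=
  A #<= B /\ ~ (B #<= A).

(** A member of [F] of least cardinality; it exists as soon as [F] is nonempty,
    see [card_minP]. *)
Definition card_min T (F : set (set T)) : set T :=
  xget set0 [set A | F A /\ forall B, F B -> A #<= B].

(** The successor of the continuum is realised inside P(P(omega)), which is
    large enough by Cantor's theorem: see [continuum_succP] and
    [continuum_succ_least]. *)
Definition continuum_succ_set : set (set (set nat)) :=
  card_min [set A | card_lt [set: set nat] A].

Definition continuum_succ : cardinal := cardinal_of continuum_succ_set.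

Section Ideals.
Variable X : Type.
Implicit Types I J K : set (set X).

Definition ideal I : Prop :=
  [/\ forall A B, I A -> I B -> I (A `|` B),
      forall A B, A `<=` B -> I B -> I A,
      forall A, finite_set A -> I A
    & ~ I setT].

Definition Fin : set (set X) := [set A | finite_set A].

Definition disjoint_seqs K : set (nat -> set X) :=
  [set A | (forall n, K (A n)) /\ trivIset setT A].

Definition partition_seqs K : set (nat -> set X) :=
  [set A | disjoint_seqs K A /\ \bigcup_n A n = setT].

Definition b_witness I J K : set (set (nat -> set X)) :=
  [set EE | EE `<=` disjoint_seqs K /\
    forall A, partition_seqs J A ->
      exists2 E, EE E &
        ~ I (\bigcup_n (A n `&` \bigcup_(i in [set i | (i <= n)%N]) E i))].

Definition b_number I J K : cardinal :=
  if pselect (b_witness I J K !=set0)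
  then cardinal_of (card_min (b_witness I J K))
  else continuum_succ.

End Ideals.

Arguments Fin X : clear implicits.

Section Products.
Implicit Types J K : set (set nat).

Definition ideal_prod J K : set (set (nat * nat)) :=
  [set A | J [set x | ~ K (xsection A x)]].

Definition ideal_prod_empty J : set (set (nat * nat)) :=
  [set A | J [set x | xsection A x <> set0]].

Definition empty_prod_ideal K : set (set (nat * nat)) :=
  [set A | forall x, K (xsection A x)].

End Products.

Lemma cardinal_ofP T U (A : set T) (B : set U) :
  cardinal_of A = cardinal_of B <-> A #= B.
Proof.
split=> [AB|AB].
  have : cardinal_of B (set_type B) by exact: card_setT_sym.
  by rewrite -AB => /card_eq_trans; apply; exact: card_setT.
apply/funext => V; apply/propext; rewrite /cardinal_of; split.
  by apply: card_eq_trans; rewrite card_eq_sym.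
exact: card_eq_trans.
Qed.

Lemma card_minP T (F : set (set T)) : F !=set0 ->
  F (card_min F) /\ forall B, F B -> card_min F #<= B.
Proof.
move=> [A0 FA0]; apply: (@xgetPex _ set0
  [set A | F A /\ forall B, F B -> A #<= B]).
pose P (D : set (set T -> T)) :=
  (forall f A, D f -> F A -> A (f A)) /\
  (forall f g A, D f -> D g -> F A -> f A = g A -> f = g).
have [C CP Ctot|D [[DF Dinj] Dmax]] := @Zorn_bigcup _ P.
  split=> [f A [D CD Df] FA|f g A [D1 CD1 D1f] [D2 CD2 D2g] FA].
    by have [DF _] := CP _ CD; exact: (DF f A).
  have [D12|D21] := Ctot _ _ CD1 CD2.
    by have [_ inj2] := CP _ CD2; apply: (inj2 f g A) => //; exact: D12.
  by have [_ inj1] := CP _ CD1; apply: (inj1 f g A) => //; exact: D21.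
have [A FA AD] : exists2 A, F A & A `<=` [set f A | f in D].
  apply: contrapT => noA.
  have out A : F A -> exists2 t, A t & ~ [set f A | f in D] t.
    move=> FA; apply: contrapT => nt; apply: noA; exists A => // t At.
    by apply: contrapT => nDt; apply: nt; exists t.
  have [t0 _ _] := out _ FA0.
  have /choice[h hP] : forall A, exists t,
      F A -> A t /\ ~ [set f A | f in D] t.
    move=> A; have [FA|nFA] := pselect (F A); last by exists t0.
    by have [t At nDt] := out _ FA; exists t.
  apply: (Dmax (D `|` [set h])).
    split; first by move=> f; left.
    move=> /(_ h (or_intror erefl)) Dh.
    by have [_] := hP _ FA0; apply; exists h.
  split=> [f A [Df|->] FA|f g A [Df|->] [Dg|->] FA fg].
  - exact: (DF f A).
  - by have [] := hP _ FA.
  - exact: (Dinj f g A).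
  - by have [_] := hP _ FA; case; exists f.
  - by have [_] := hP _ FA; case; exists g.
  - by [].
exists A; split=> // B FB.
apply: (card_le_trans (subset_card_le AD)).
apply: (card_le_trans (card_image_le _ _)).
have Dinj' : {in D &, injective (fun f : set T -> T => f B)}.
  by move=> f g /set_mem Df /set_mem Dg; exact: (Dinj f g B).
rewrite -(card_le_eql (inj_card_eq Dinj')).
by apply: subset_card_le => _ [f Df <-]; exact: (DF f B).
Qed.

Lemma card_le_total T U (A : set T) (B : set U) : A #<= B \/ B #<= A.
Proof.
pose A' : set (T + U) := inl @` A; pose B' : set (T + U) := inr @` B.
have AA' : A' #= A by apply: inj_card_eq => x y _ _ [].
have BB' : B' #= B by apply: inj_card_eq => x y _ _ [].
rewrite -(card_le_eql AA') -(card_le_eqr BB') -(card_le_eqr AA') -(card_le_eql BB').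
have [|[->|->] min] := @card_minP _ [set A'; B'].
- by exists A'; left.
- by left; apply: min; right.
- by right; apply: min; left.
Qed.

Lemma continuum_succP : card_lt [set: set nat] continuum_succ_set.
Proof.
apply: (card_minP _).1; exists setT; split.
  have inj : {in [set: set nat] &, injective (fun x : set nat => [set x])}.
    by move=> x y _ _ /= e; have : [set x] x by []; rewrite e.
  by rewrite -(card_le_eql (inj_card_eq inj)); apply: subset_card_le.
move=> /pcard_leTP[f].
pose D : set (set nat) := [set x | exists2 S : set (set nat), f S = x & ~ S x].
have [Df|nDf] := pselect (D (f D)).
  case: (Df) => S fSD; suff -> : S = D by apply.
  by apply: (@inj _ _ setT f); rewrite ?inE.
by apply: (nDf); exists D.
Qed.

Lemma continuum_succ_least T (B : set T) :
  card_lt [set: set nat] B -> continuum_succ_set #<= B.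
Proof.
move=> [cB Bc]; have [//|BP] := card_le_total continuum_succ_set B.
have /pcard_leP[f] := BP.
have fB : f @` B #= B by apply: inj_card_eq; exact: inj.
rewrite -(card_le_eqr fB).
apply: (card_minP (ex_intro _ _ continuum_succP)).2.
by split; rewrite ?(card_le_eqr fB) ?(card_le_eql fB).
Qed.

(* Main.v *)
Require Import Defs.
From mathcomp Require Import all_boot.
From mathcomp Require Import boolp classical_sets functions cardinality.
From mathcomp Require Import
  sequences(seqDU, subset_seqDU, trivIset_seqDU, bigsetU_seqDU).

(** A Katetov map [f] from [(I, J)] to [(I', J')] makes [b(I, J, Fin)] at most
    [b(I', J', Fin)]: partitions pull back along [f], and finite sets push
    forward along [f], their images being made disjoint without changing the
    partial unions. Parts (2) and (3) follow because the fibre inclusions and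
    the coordinate projections are Katetov maps in both directions. In part (1)
    the vertical lines [A_n] defeat every sequence [E] of finite sets at once:
    the section at [x] of the union of the [A_n `&` \bigcup_(i <= n) E_i] only
    involves [E_0, ..., E_x]. So no witnessing family exists. *)

Set Implicit Arguments.
Unset Strict Implicit.
Unset Printing Implicit Defensive.

Local Open Scope classical_set_scope.
Local Open Scope card_scope.

Definition downward_closed X (I : set (set X)) : Prop :=
  forall A B, A `<=` B -> I B -> I A.

Lemma ideal_downward_closed X (I : set (set X)) : ideal I -> downward_closed I.
Proof. by case. Qed.

Lemma ideal_set0 X (I : set (set X)) : ideal I -> I set0.
Proof. by case=> _ _ Ifin _; apply: Ifin; exact: finite_set0. Qed.

Lemma ideal_bigcup_ltn X (I : set (set X)) (A : nat -> set X) n :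
  ideal I -> (forall i, I (A i)) -> I (\bigcup_(i < n) A i).
Proof.
move=> idealI IA; rewrite bigcup_mkord.
by apply: (big_ind I) => //; [exact: ideal_set0 | case: idealI].
Qed.

Lemma Fin_downward_closed X : downward_closed (Fin X).
Proof. by move=> A B; exact: sub_finite_set. Qed.

Lemma ideal_prod_empty_downward_closed J :
  downward_closed J -> downward_closed (ideal_prod_empty J).
Proof.
move=> Jdown A B AB; apply: Jdown => x /= + Bx0; apply.
by rewrite -subset0 -Bx0; exact: le_xsection.
Qed.

Lemma empty_prod_ideal_downward_closed K :
  downward_closed K -> downward_closed (empty_prod_ideal K).
Proof.
by move=> Kdown A B AB KB x; apply: Kdown (KB x); exact: le_xsection.
Qed.

Lemma empty_prod_ideal_sub_ideal_prod J K :
  J set0 -> empty_prod_ideal K `<=` ideal_prod J K.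
Proof.
move=> J0 A KA; rewrite /ideal_prod /=.
have -> // : [set x | ~ K (xsection A x)] = set0.
by rewrite -subset0 => x; apply.
Qed.

Lemma Fin_sub_empty_prod_ideal K :
  ideal K -> Fin (nat * nat)%type `<=` empty_prod_ideal K.
Proof.
move=> [_ _ Kfin _] A Afin x; apply: Kfin.
apply: (@sub_finite_set _ _ (snd @` A)); last exact: finite_image.
by move=> y /xsectionP Axy; exists (x, y).
Qed.

Definition card_minorizes S T (F : set (set S)) (G : set (set T)) : Prop :=
  forall B, G B -> exists2 A, F A & A #<= B.

Lemma card_minorizes_nonempty S T (F : set (set S)) (G : set (set T)) :
  card_minorizes F G -> G !=set0 -> F !=set0.
Proof. by move=> FG [B /FG[A FA _]]; exists A. Qed.

Lemma card_min_le S T (F : set (set S)) (G : set (set T)) :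
  card_minorizes F G -> G !=set0 -> card_min F #<= card_min G.
Proof.
move=> FG G0; have [A FA] := FG _ (card_minP G0).1.
exact/card_le_trans/(card_minP (card_minorizes_nonempty FG G0)).2.
Qed.

Lemma b_number_eq X Y (I J K : set (set X)) (I' J' K' : set (set Y)) :
  card_minorizes (b_witness I J K) (b_witness I' J' K') ->
  card_minorizes (b_witness I' J' K') (b_witness I J K) ->
  b_number I J K = b_number I' J' K'.
Proof.
move=> le ge; rewrite /b_number.
case: pselect => [W|nW]; case: pselect => [W'|nW'] //.
- apply/cardinal_ofP; rewrite card_eq_le.
  by apply/andP; split; exact: card_min_le.
- by case: nW'; exact: card_minorizes_nonempty W.
- by case: nW; exact: card_minorizes_nonempty W'.
Qed.

Lemma b_number_continuum_succ X (I J K : set (set X)) :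
  b_witness I J K = set0 -> b_number I J K = continuum_succ.
Proof. by rewrite /b_number => ->; case: pselect => // -[]. Qed.

Definition katetov_map X Y (f : Y -> X) (I : set (set X)) (I' : set (set Y)) :
  Prop := forall A, I A -> I' (f @^-1` A).

Definition staircase X (A E : nat -> set X) : set X :=
  \bigcup_n (A n `&` \bigcup_(i in [set i | (i <= n)%N]) E i).

Definition disjoint_images X Y (f : Y -> X) (E : nat -> set Y) : nat -> set X :=
  seqDU (fun n => f @` E n).

Section KatetovMonotonicity.
Variables (X Y : Type) (f : Y -> X).
Variables (I J K : set (set X)) (I' J' K' : set (set Y)).

Lemma partition_seqs_preimage A :
  katetov_map f J J' ->
  partition_seqs J A -> partition_seqs J' (fun n => f @^-1` A n).
Proof.
move=> fJ [[JA Adisj] Acover]; split; first split.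
- by move=> n; exact: fJ.
- by move=> i j _ _ [y [Aiy Ajy]]; apply: Adisj => //; exists (f y).
- by rewrite -preimage_bigcup Acover preimage_setT.
Qed.

Lemma disjoint_images_disjoint_seqs E :
  downward_closed K -> (forall A, K' A -> K (f @` A)) ->
  disjoint_seqs K' E -> disjoint_seqs K (disjoint_images f E).
Proof.
move=> Kdown fK [K'E _]; split=> [n|]; last exact: trivIset_seqDU.
by apply: Kdown (fK _ (K'E n)); exact: subset_seqDU.
Qed.

Lemma bigcup_disjoint_images E n :
  \bigcup_(i < n) disjoint_images f E i = \bigcup_(i < n) f @` E i.
Proof. by rewrite !bigcup_mkord -bigsetU_seqDU. Qed.

Lemma staircase_preimage (A : nat -> set X) E :
  staircase (fun n => f @^-1` A n) E `<=`
  f @^-1` staircase A (disjoint_images f E).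
Proof.
move=> y [n _ [Anfy [i lein Eiy]]]; exists n => //; split=> //.
by rewrite (bigcup_disjoint_images E n.+1); exists i => //; exists y.
Qed.

Lemma b_witness_disjoint_images EE :
  downward_closed I' -> downward_closed K ->
  katetov_map f I I' -> katetov_map f J J' ->
  (forall A, K' A -> K (f @` A)) ->
  b_witness I' J' K' EE -> b_witness I J K (disjoint_images f @` EE).
Proof.
move=> I'down Kdown fI fJ fK [EEK' EEwit].
split=> [_ [E /EEK' K'E <-]|A JA].
  exact: disjoint_images_disjoint_seqs K'E.
have [E EEE nI'E] := EEwit _ (partition_seqs_preimage fJ JA).
exists (disjoint_images f E); first by exists E.
by move=> /fI/(I'down _ _ (@staircase_preimage A E)).
Qed.

End KatetovMonotonicity.

Lemma b_witness_Fin_card_minorizes X Y (f : Y -> X)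
    (I J : set (set X)) (I' J' : set (set Y)) :
  downward_closed I' -> katetov_map f I I' -> katetov_map f J J' ->
  card_minorizes (b_witness I J (Fin X)) (b_witness I' J' (Fin Y)).
Proof.
move=> I'down fI fJ EE EEwit; exists (disjoint_images f @` EE).
  apply: b_witness_disjoint_images EEwit => //.
    exact: Fin_downward_closed.
  by move=> A; exact: finite_image.
exact: card_image_le.
Qed.

Lemma b_number_Fin_eq X Y (f : Y -> X) (g : X -> Y)
    (I J : set (set X)) (I' J' : set (set Y)) :
  downward_closed I -> downward_closed I' ->
  katetov_map f I I' -> katetov_map f J J' ->
  katetov_map g I' I -> katetov_map g J' J ->
  b_number I J (Fin X) = b_number I' J' (Fin Y).
Proof.
move=> Idown I'down fI fJ gI' gJ'.
apply: b_number_eq; first exact: (b_witness_Fin_card_minorizes (f := f)).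
exact: (b_witness_Fin_card_minorizes (f := g)).
Qed.

Section IdealProducts.
Implicit Types J K : set (set nat).

Lemma katetov_map_fst J :
  downward_closed J -> katetov_map fst J (ideal_prod_empty J).
Proof.
move=> Jdown A; apply: Jdown => x /= Ax0; apply: contrapT => nAx; apply: Ax0.
by rewrite -subset0 => y /xsectionP.
Qed.

Lemma katetov_map_pair_right J (y : nat) :
  downward_closed J -> katetov_map (fun x => (x, y)) (ideal_prod_empty J) J.
Proof.
by move=> Jdown A; apply: Jdown => x /xsectionP Axy /= Ax0; rewrite Ax0 in Axy.
Qed.

Lemma katetov_map_snd K : katetov_map snd K (empty_prod_ideal K).
Proof. by move=> A KA x; rewrite xsection_preimage_snd. Qed.

Lemma katetov_map_pair_left K (x : nat) :
  katetov_map (pair x) (empty_prod_ideal K) K.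
Proof. by move=> A /(_ x); rewrite xsectionE. Qed.

Definition vertical_line (n : nat) : set (nat * nat) := fst @^-1` [set n].

Lemma vertical_line_partition J K :
  ideal J -> K set0 -> partition_seqs (ideal_prod J K) vertical_line.
Proof.
move=> [_ Jdown Jfin _] K0; split; first split=> [n|].
- apply: Jdown (Jfin _ (finite_set1 n)) => x /= nKx.
  apply: contrapT => xn; apply: nKx.
  have -> // : xsection (vertical_line n) x = set0.
  by rewrite -subset0 => y /xsectionP.
- exact: trivIset_preimage1.
- by apply/seteqP; split=> // p _; exists p.1.
Qed.

Lemma xsection_staircase_vertical_line E x :
  xsection (staircase vertical_line E) x = \bigcup_(i < x.+1) xsection (E i) x.
Proof.
apply/seteqP; split=> [y /xsectionP[_ _ [/= <- [i leix Exy]]]|y [i leix Exy]].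
  by exists i => //; apply/xsectionP.
by apply/xsectionP; exists x => //; split=> //; exists i => //; apply/xsectionP.
Qed.

Lemma staircase_vertical_line_empty_prod K E :
  ideal K -> (forall n, empty_prod_ideal K (E n)) ->
  empty_prod_ideal K (staircase vertical_line E).
Proof.
move=> idealK KE x; rewrite xsection_staircase_vertical_line.
by apply: ideal_bigcup_ltn => // i; exact: KE.
Qed.

Lemma b_witness_ideal_prod J K J' K' (L : set (set (nat * nat))) :
  J set0 -> ideal K -> ideal J' -> K' set0 -> L `<=` empty_prod_ideal K ->
  b_witness (ideal_prod J K) (ideal_prod J' K') L = set0.
Proof.
move=> J0 idealK idealJ' K'0 LK; rewrite -subset0 => EE [EEL EEwit].
have [E /EEL[LE _]] := EEwit _ (vertical_line_partition idealJ' K'0); apply.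
apply: empty_prod_ideal_sub_ideal_prod => //.
by apply: staircase_vertical_line_empty_prod => // n; exact/LK/LE.
Qed.

Lemma b_number_ideal_prod J K : ideal J -> ideal K ->
  b_number (ideal_prod J K) (ideal_prod J K) (Fin (nat * nat)%type) =
  continuum_succ.
Proof.
move=> idealJ idealK; apply/b_number_continuum_succ/b_witness_ideal_prod => //.
- exact: ideal_set0.
- exact: ideal_set0.
- exact: Fin_sub_empty_prod_ideal.
Qed.

Lemma b_number_ideal_prod_empty J J' :
  downward_closed J -> downward_closed J' ->
  b_number (ideal_prod_empty J) (ideal_prod_empty J') (Fin (nat * nat)%type) =
  b_number J J' (Fin nat).
Proof.
move=> Jdown J'down; apply: (b_number_Fin_eq (f := fun x => (x, 0)) (g := fst)).
- exact: ideal_prod_empty_downward_closed.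
- exact: Jdown.
- exact: katetov_map_pair_right.
- exact: katetov_map_pair_right.
- exact: katetov_map_fst.
- exact: katetov_map_fst.
Qed.

Lemma b_number_empty_prod_ideal K K' :
  downward_closed K ->
  b_number (empty_prod_ideal K) (empty_prod_ideal K') (Fin (nat * nat)%type) =
  b_number K K' (Fin nat).
Proof.
move=> Kdown; apply: (b_number_Fin_eq (f := pair 0) (g := snd)).
- exact: empty_prod_ideal_downward_closed.
- exact: Kdown.
- exact: katetov_map_pair_left.
- exact: katetov_map_pair_left.
- exact: katetov_map_snd.
- exact: katetov_map_snd.
Qed.

End IdealProducts.

Theorem theorem5p14 (J K : set (set nat)) (idealJ : ideal J) (idealK : ideal K) :
  [/\ forall I : set (set (nat * nat)), I = ideal_prod J K ->
        b_number I I (Fin (nat * nat)%type) = continuum_succ,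
      forall I : set (set (nat * nat)), I = ideal_prod_empty J ->
        b_number I I (Fin (nat * nat)%type) = b_number J J (Fin nat)
    & forall I : set (set (nat * nat)), I = empty_prod_ideal K ->
        b_number I I (Fin (nat * nat)%type) = b_number K K (Fin nat)].
Proof.
have Jdown := ideal_downward_closed idealJ.
have Kdown := ideal_downward_closed idealK.
split=> I ->.
- exact: b_number_ideal_prod.
- exact: b_number_ideal_prod_empty.
- exact: b_number_empty_prod_ideal.
Qed.
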